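(* Let $\mathcal{S}$ be the collection of parametrized families of graphs with the equivalence relation $\sim$ (both defined in the context). To each graph $G$ and each finite set $F=\{f_1,\dots,f_k\}$ of signals on $G$ associate the parametrized family $G_F: M_F\to\mathcal{G}$, where $M_F=\mathbb{R}_{\geq 0}^{k+1}$ and, for $x=(x_0,x_1,\dots,x_k)\in M_F$, $G_F(x)$ is the graph on the vertex set of $G$ in which a pair of nodes $u,v$ is connected by an edge if $$\Delta(u,v)=\Big(\sum_{1\leq i\leq k}x_i\,(f_i(u)-f_i(v))^2 + d_G(u,v)^2\Big)^{1/2}\leq x_0 .$$ Then associating $G,F$ with $G_F:M_F\to\mathcal{G}$ is a graph-signal coupling (in the sense of the definition in the context).
   Context: All graphs are finite, unweighted and simple; $\mathcal{G}$ denotes the collection of finite graphs, and $d_G$ is the distance on $G$. A signal on $G=(V,E)$, $V=\{v_1,\dots,v_n\}$, is a function $f:V\to\mathbb{R}$. Parametrized families and equivalence. An element of $\mathcal{S}$ is a map $\gamma: M\to\mathcal{G}$, where $M$ is a parameter space such as a topological space or a manifold. Given $\gamma_i:M_i\to\mathcal{G}$, $i=1,2$, a morphism from $\gamma_1$ to $\gamma_2$ is a map $\phi:M_1\to M_2$ such that $\gamma_1=\gamma_2\circ\phi$ (usually required to be continuous if the $M_i$ are topological spaces, and differentiable if the $M_i$ are differentiable manifolds). Write $\gamma_1\leq\gamma_2$ if there is a morphism from $\gamma_1$ to $\gamma_2$, and $\gamma_1\sim\gamma_2$ if $\gamma_1\leq\gamma_2$ and $\gamma_2\leq\gamma_1$.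 Graph-signal coupling. A graph-signal coupling consists of a set of objects $\mathcal{S}$, an equivalence relation $\sim$ on $\mathcal{S}$, and, for each graph $G$ and each finite set of signals $F$ on $G$, an object $G_F\in\mathcal{S}$ (written $G_f$ if $F=\{f\}$), such that: 1) Composability: for each finite set $F'$ of signals on $G$, there is an object $(G_F)_{F'}\in\mathcal{S}$. 2) Commutativity and associativity: $(G_F)_{F'}\sim G_{F\cup F'}$. 3) Recoverability of $G$: there is a base map $b:\mathcal{S}\to\mathcal{G}$ such that $b(G_F)=G$. 4) Recoverability of signal: $G_f=G_{f'}$ implies $|f(v_i)-f(v_j)|=|f'(v_i)-f'(v_j)|$ for $1\leq i,j\leq n$. Moreover, if $f=af'+c$ for a scalar $a\neq 0$ and a constant signal $c$, then $G_f\sim G_{f'}$.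
   Formalization: For disconnected G, d_G(u,v) between different components is taken to be an arbitrary finite value > 1 depending only on G; with infinite distance signal recoverability fails (two isolated vertices give edgeless G_f(x) for every f). Connected graphs are unaffected. *)

(* Defs.v *)
From mathcomp Require Import all_boot all_order all_algebra finmap.
From mathcomp Require Import all_classical all_reals all_analysis.
From Stdlib Require Import RelationClasses.

Set Implicit Arguments.
Unset Strict Implicit.
Unset Printing Implicit Defensive.

Import GRing.Theory Num.Theory numFieldNormedType.Exports.

Local Open Scope fset_scope.
Local Open Scope ring_scope.

Record graph := Graph {
  vertex :> finType;
  adj : rel vertex;
  adj_sym : symmetric adj;
  adj_irr : irreflexive adj }.

Definition signal (R : realType) (G : graph) := {ffun G -> R}.

Definition walk (G : graph) (n : nat) : rel G :=
  [rel u v | [exists p : n.-tuple G, path (adj (g := G)) u p && (last u p == v)]].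

(* Least length of a walk from u to v; a shortest walk between two vertices of
   the same component has fewer than #|G| edges. *)
Definition hops (G : graph) (u v : G) : nat :=
  find (fun n => walk n u v) (iota 0 #|G|).

(* The formula for Delta needs a real d_G(u,v) for every pair of vertices: the
   shortest-path distance inside a component, and a finite value c, left as a
   parameter, across components. For connected graphs c is irrelevant. *)
Definition dist (R : realType) (c : R) (G : graph) (u v : G) : R :=
  if connect (adj (g := G)) u v then (hops u v)%:R else c.

Lemma walk_sym (G : graph) n : symmetric (@walk G n).
Proof.
suff half (u v : G) : walk n u v -> walk n v u by move=> u v; apply/idP/idP; apply: half.
rewrite /walk /= => /existsP[p /andP[pp /eqP <-]]; apply/existsP.
have sz : size (rev (belast u p)) == n by rewrite size_rev size_belast size_tuple.
exists (Tuple sz) => /=; apply/andP; split.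
  by rewrite rev_path (eq_path (e' := adj (g := G))) // => x y /=; rewrite adj_sym.
case: {pp sz} (tval p) => [|x s] //=.
by rewrite rev_cons last_rcons.
Qed.

Lemma dist_sym (R : realType) (c : R) (G : graph) (u v : G) :
  dist c u v = dist c v u.
Proof.
have -> : dist c u v = if connect (adj (g := G)) v u then (hops u v)%:R else c.
  by rewrite /dist (sym_connect_sym (adj_sym (g := G))).
rewrite /dist /hops.
by under eq_find do rewrite walk_sym.
Qed.

(* Delta for the signals listed in fs; only x 1, ..., x (size fs) are read. *)
Definition Delta (R : realType) (c : R) (G : graph) (fs : seq (signal R G))
    (x : nat -> R) (u v : G) : R :=
  Num.sqrt (\sum_(i < size fs) x i.+1 * (fs`_i u - fs`_i v) ^+ 2
            + dist c u v ^+ 2).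

Definition threshold_rel (R : realType) (c : R) (G : graph)
    (fs : seq (signal R G)) (x : nat -> R) : rel G :=
  [rel u v | (u != v) && (Delta c fs x u v <= x 0%N)].

Lemma threshold_sym (R : realType) (c : R) (G : graph)
    (fs : seq (signal R G)) (x : nat -> R) :
  symmetric (threshold_rel c fs x).
Proof.
move=> u v; rewrite /threshold_rel /= eq_sym /Delta dist_sym.
by under eq_bigr do rewrite -[_ - _ in X in _ * X]opprB sqrrN.
Qed.

Lemma threshold_irr (R : realType) (c : R) (G : graph)
    (fs : seq (signal R G)) (x : nat -> R) :
  irreflexive (threshold_rel c fs x).
Proof. by move=> u; rewrite /threshold_rel /= eqxx. Qed.

Definition threshold_graph (R : realType) (c : R) (G : graph)
    (fs : seq (signal R G)) (x : nat -> R) : graph :=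
  Graph (threshold_sym c fs x) (threshold_irr c fs x).

(* A parameter space is a subset of a topological space, with the subspace
   topology; this loses no generality (take the whole space). Keeping the
   ambient space is what lets equality of families compare parameter spaces as
   sets of points, as equality of maps does in set theory. *)
Record family := Family {
  ambient : topologicalType;
  params : set ambient;
  graph_at : params -> graph }.

Arguments params : clear implicits.
Arguments graph_at : clear implicits.

Definition family_le (s1 s2 : family) : Prop :=
  exists phi : params s1 -> params s2,
    continuous phi /\ forall x, graph_at s1 x = graph_at s2 (phi x).

Definition family_equiv (s1 s2 : family) : Prop :=
  family_le s1 s2 /\ family_le s2 s1.

(* The orthant of nonnegative vectors (x_0, ..., x_k), with R^(k+1) embedded in
   the product space R^nat as the sequences vanishing beyond index k. *)
Definition orthant (R : realType) (k : nat) : set {ptws nat -> R} :=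
  [set x | (forall i, 0 <= x i) /\ (forall i, (k < i)%N -> x i = 0)].

Arguments orthant : clear implicits.

Definition signal_family (R : realType) (c : R) (G : graph)
    (fs : seq (signal R G)) : family :=
  Family (fun x : orthant R (size fs) => threshold_graph c fs (val x)).

(* obj G F is the object G_F, and comp (obj G F) G F' is (G_F)_{F'}: it depends
   on G_F only as an element of S. *)
Record is_coupling (R : realType) (S : Type) (sim : S -> S -> Prop)
    (obj : forall G : graph, {fset signal R G} -> S) : Prop := IsCoupling {
  sim_equivalence : Equivalence sim;
  composable : exists comp : S -> forall G : graph, {fset signal R G} -> S,
    forall (G : graph) (F F' : {fset signal R G}),
      sim (comp (obj G F) G F') (obj G (F `|` F'));
  recover_graph : exists b : S -> graph,
    forall (G : graph) (F : {fset signal R G}), b (obj G F) = G;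
  recover_signal : forall (G : graph) (f f' : signal R G),
    obj G [fset f] = obj G [fset f'] ->
    forall u v : G, `|f u - f v| = `|f' u - f' v|;
  affine_equiv : forall (G : graph) (f f' : signal R G) (a c : R),
    a != 0 -> (forall v, f v = a * f' v + c) ->
    sim (obj G [fset f]) (obj G [fset f']) }.

(* Main.v *)
(** Only the squared differences [(f u - f v)^2] of a signal [f] enter [Delta],
    and they enter linearly. If those of every [f_i] are a nonnegative multiple
    of those of some [g_(h i)], the linear map of orthants sending [x] to the
    point with j-th coordinate [\sum_(h i = j) lambda_i x_i] is a morphism of
    families; this gives the equivalence of affinely related signals. Conversely
    a family determines its graph, as its value at [(1, 0, ..., 0)], and the
    squared differences of its signals, as the least [x_0] that joins [u] and
    [v] along [x = (x_0, e_i)]. So equal families have signals with the same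
    squared differences, and adding [F'] to both gives equivalent families even
    when [F'] meets the two sets of signals differently. Hence [(G_F)_F'] may be
    defined as [G_(F u F')] for any representative [F]. *)
Require Import Defs.
From mathcomp Require Import all_boot all_order all_algebra finmap.
From mathcomp Require Import all_classical all_reals all_analysis.
From Stdlib Require Import RelationClasses JMeq.

Set Implicit Arguments.
Unset Strict Implicit.
Unset Printing Implicit Defensive.

Import Order.TTheory GRing.Theory Num.Theory numFieldNormedType.Exports.

Local Open Scope fset_scope.
Local Open Scope ring_scope.

(** * Families up to morphism, and equality of graphs *)

Lemma family_le_refl s : family_le s s.
Proof. by exists id; split=> // x; exact: cvg_id. Qed.

Lemma family_le_trans s1 s2 s3 :
  family_le s1 s2 -> family_le s2 s3 -> family_le s1 s3.
Proof.
move=> [p [cp ep]] [q [cq eq]]; exists (q \o p); split=> x /=.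
  by apply: continuous_comp; [exact: cp|exact: cq].
by rewrite ep eq.
Qed.

Lemma family_equiv_equivalence : Equivalence family_equiv.
Proof.
split=> [s|s t []|s t r [st ts] [tr rt]]; split=> //; try exact: family_le_refl.
  exact: family_le_trans st tr.
exact: family_le_trans rt ts.
Qed.

(** The type of [adj] varies with the graph, so equal graphs first give a heterogeneous equality;
    both relations live on [V], so [JMeq_eq] makes it an ordinary one. *)
Lemma graph_eq_adj (V : finType) (e e' : rel V) s i s' i' :
  @Graph V e s i = @Graph V e' s' i' -> e = e'.
Proof.
move=> E; apply: JMeq_eq.
have adj_cong G H : G = H -> JMeq (@adj G) (@adj H) by move=> ->.
exact: adj_cong E.
Qed.

Lemma eq_graph (V : finType) (e e' : rel V) s i s' i' :
  e = e' -> @Graph V e s i = @Graph V e' s' i'.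
Proof. by move=> E; subst e'; congr Graph; exact: Prop_irrelevance. Qed.

Section SignalFamily.
Variable R : realType.
Implicit Types (c : R) (G : graph) (k : nat) (x : nat -> R).

(** * Linear morphisms between orthants *)

Definition scaled G (f g : signal R G) : Prop :=
  exists2 a : R, 0 <= a & forall u v, (f u - f v) ^+ 2 = a * (g u - g v) ^+ 2.

Lemma scaled_refl G (f : signal R G) : scaled f f.
Proof. by exists 1 => // u v; rewrite mul1r. Qed.

Lemma scaled_affine G (f g : signal R G) (a b : R) :
  (forall v, f v = a * g v + b) -> scaled f g.
Proof.
move=> fE; exists (a ^+ 2); first exact: sqr_ge0.
by move=> u v; rewrite !fE opprD addrACA subrr addr0 -mulrBr exprMn.
Qed.

Lemma eq_sqr_norm (a b : R) : a ^+ 2 = b ^+ 2 -> `|a| = `|b|.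
Proof. by move=> ab; rewrite -!sqrtr_sqr ab. Qed.

Section Reweighting.
Variables (k l : nat) (w : nat -> nat -> R).
Hypotheses (w_ge0 : forall i j, 0 <= w i j).
Hypothesis w_eq0 : forall i j, (l <= j)%N -> w i j = 0.

Definition reweight x : nat -> R :=
  fun n => if n is j.+1 then \sum_(i < k) x i.+1 * w i j else x 0%N.

Lemma reweight_orthant x : orthant R k x -> orthant R l (reweight x).
Proof.
move=> [x_ge0 _]; split=> [[|j] //=|[|j] // lj /=].
  by apply: sumr_ge0 => i _; rewrite mulr_ge0.
by rewrite big1 // => i _; rewrite w_eq0 ?mulr0.
Qed.

Definition reweight_params (x : orthant R k) : orthant R l :=
  exist _ (reweight (val x)) (mem_set (reweight_orthant (set_mem (valP x)))).

Lemma orthant_coord_continuous n :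
  continuous (fun x : orthant R k => (val x : {ptws nat -> R}) n).
Proof.
move=> x; apply: (@continuous_comp _ {ptws nat -> R} _ set_val (fun y => y n)).
  exact: initial_continuous.
exact: (@proj_continuous _ (fun=> R)).
Qed.

(** The orthant has the subspace topology of a product, so continuity is checked coordinatewise, on
    finite sums of coordinates times constants. *)
Lemma reweight_params_continuous : continuous reweight_params.
Proof.
apply: continuous_comp_initial => x.
have image_filter := fmap_filter (set_val \o reweight_params) (nbhs_filter x).
apply/(@pointwise_cvgP _ _ _ _ image_filter) => -[|j] /=.
  exact: orthant_coord_continuous.
apply: cvg_big => [|i _]; first exact: add_continuous.
by apply: cvgM; [exact: orthant_coord_continuous|exact: cvg_cst].
Qed.

End Reweighting.

Lemma signal_family_le c G (fs gs : seq (signal R G)) :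
  (forall f, f \in fs -> exists2 g, g \in gs & scaled f g) ->
  family_le (signal_family c fs) (signal_family c gs).
Proof.
move=> fs_gs.
have /choice[h hP] (i : nat) : exists p : nat * R, (i < size fs)%N ->
    [/\ (p.1 < size gs)%N, 0 <= p.2 &
      forall u v, (fs`_i u - fs`_i v) ^+ 2 =
                  p.2 * (gs`_(p.1) u - gs`_(p.1) v) ^+ 2].
  have [ifs|?] := ltnP i (size fs); last by exists (0%N, 0).
  have [g ggs [a a0 fg]] := fs_gs _ (mem_nth 0 ifs).
  by exists (index g gs, a) => _ /=; rewrite index_mem nth_index.
(* The whole weight of signal [i] goes to its partner [(h i).1], scaled by [(h i).2], so after
   exchanging the sums a single [j] survives for each [i]. *)
pose w i j := if (i < size fs)%N && (j == (h i).1) then (h i).2 else 0.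
have w_ge0 i j : 0 <= w i j.
  by rewrite /w; case: ifP => // /andP[/hP[]].
have w_eq0 i j : (size gs <= j)%N -> w i j = 0.
  rewrite /w leqNgt; case: ifP => // /andP[/hP[+ _ _] /eqP ->].
  by move=> ->.
exists (reweight_params w_ge0 w_eq0); split.
  exact: reweight_params_continuous.
move=> x /=; apply: eq_graph; apply/funext => u; apply/funext => v.
rewrite /threshold_rel /= /Delta /=; congr (_ && (Num.sqrt (_ + _) <= _)).
under [RHS]eq_bigr do rewrite mulr_suml.
rewrite exchange_big /=; apply: eq_bigr => i _.
have [hi _ ->] := hP _ (ltn_ord i).
rewrite (bigD1 (Ordinal hi)) //= big1 ?addr0 => [|j].
  by rewrite /w ltn_ord eqxx /= mulrA.
by rewrite -val_eqE /= /w => /negbTE ->; rewrite andbF mulr0 mul0r.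
Qed.

Lemma signal_family_equiv c G (fs gs : seq (signal R G)) :
  (forall f, f \in fs -> exists2 g, g \in gs & scaled f g) ->
  (forall g, g \in gs -> exists2 f, f \in fs & scaled g f) ->
  family_equiv (signal_family c fs) (signal_family c gs).
Proof. by move=> ? ?; split; exact: signal_family_le. Qed.

(** * What equality of families determines *)

(* Heterogeneous equality lets a point of an unknown ambient space be compared
   with a point of R^nat. *)
Definition takes (s : Defs.family) x G : Prop :=
  exists2 p : params s, JMeq (val p) x & graph_at s p = G.

Lemma takes_signal_family c G (fs : seq (signal R G)) x H :
  takes (signal_family c fs) x H <->
  orthant R (size fs) x /\ threshold_graph c fs x = H.
Proof.
split=> [[p px <-]|[xP <-]].
  have <- : val p = x := JMeq_eq px.
  by split=> //; exact: set_mem (valP p).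
by exists (exist _ x (mem_set xP)).
Qed.

Lemma orthant_inj k l : orthant R k = orthant R l -> k = l.
Proof.
suff le_kl m n : orthant R m = orthant R n -> (m <= n)%N.
  by move=> E; apply/eqP; rewrite eqn_leq !le_kl.
move=> E; rewrite leqNgt; apply/negP => nm.
(* This unit vector lies in the orthant of index [m] but is nonzero beyond index [n]. *)
have : orthant R m (fun i => (i == m)%:R).
  by split=> i; [exact: ler0n|rewrite ltn_neqAle eq_sym => /andP[/negbTE ->]].
by rewrite E => -[_ /(_ _ nm)/eqP]; rewrite eqxx oner_eq0.
Qed.

(** Being a predicate on families, [takes] transports along their equality without casts between
    dependent fields; it records both the parameter points and the graph at each. *)
Lemma signal_family_inj c c' G G' (fs : seq (signal R G))
    (fs' : seq (signal R G')) :
  signal_family c fs = signal_family c' fs' ->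
  size fs = size fs' /\ forall x, orthant R (size fs) x ->
    threshold_graph c fs x = threshold_graph c' fs' x.
Proof.
move=> E.
have takesE x H : orthant R (size fs) x /\ threshold_graph c fs x = H <->
    orthant R (size fs') x /\ threshold_graph c' fs' x = H.
  by rewrite -!takes_signal_family E.
split=> [|x xP].
  apply: orthant_inj; apply/seteqP; split=> x xP.
    by have [/(_ (conj xP erefl))[]] := takesE x (threshold_graph c fs x).
  by have [_ /(_ (conj xP erefl))[]] := takesE x (threshold_graph c' fs' x).
by have [/(_ (conj xP erefl))[]] := takesE x (threshold_graph c fs x).
Qed.

(** * Recovery of the graph *)

Lemma dist_ge0 c G (u v : G) : 0 <= c -> 0 <= dist c u v.
Proof. by rewrite /dist; case: ifP. Qed.

Lemma walk0 G (u v : G) : walk 0 u v = (u == v).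
Proof.
apply/existsP/eqP => [[p /andP[_ /eqP <-]]|->]; first by rewrite tuple0.
by exists [tuple] => /=.
Qed.

Lemma walk1 G (u v : G) : walk 1 u v = adj u v.
Proof.
apply/existsP/idP => [[p]|uv].
  by case/tupleP: p => w p; rewrite tuple0 /= andbT => /andP[uw /eqP <-].
by exists [tuple v] => /=; rewrite uv eqxx.
Qed.

Lemma dist_le1 c G (u v : G) :
  1 < c -> u != v -> (dist c u v <= 1) = adj u v.
Proof.
move=> c_gt1 uv; rewrite /dist.
(* Two distinct vertices put both lengths 0 and 1 in the range searched by [hops]. *)
have cardG : (1 < #|G|)%N.
  by apply: leq_trans (max_card [set u; v]); rewrite cards2 uv.
have hopsE : (hops u v <= 1)%N = adj u v.
  rewrite /hops; case: #|G| cardG => [|[|n]] // _ /=.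
  by rewrite walk0 (negbTE uv) walk1; case: adj.
case: ifP => [_|/negP nuv]; first by rewrite (ler_nat R _ 1).
rewrite leNgt c_gt1; apply/esym/negP => /connect1; exact: nuv.
Qed.

Definition unit_scale : nat -> R := fun n => (n == 0%N)%:R.

Lemma unit_scale_orthant k : orthant R k unit_scale.
Proof. by split=> [i|[|i]]; rewrite /unit_scale ?ler0n. Qed.

Lemma threshold_graph_unit c G (fs : seq (signal R G)) :
  1 < c -> threshold_graph c fs unit_scale = G.
Proof.
move=> c_gt1; case: G fs => V e s i fs; apply: eq_graph.
apply/funext => u; apply/funext => v; rewrite /threshold_rel /= /Delta big1.
  rewrite add0r sqrtr_sqr ger0_norm ?dist_ge0 ?(le_trans ler01 (ltW c_gt1)) //.
  case: eqVneq => [->|uv] /=; first by rewrite i.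
  exact: dist_le1.
by move=> j _; rewrite /unit_scale mul0r.
Qed.

(** * Recovery of the squared differences *)

Definition probe (r : R) (i : nat) : nat -> R :=
  fun n => if n is j.+1 then (j == i)%:R else r.

Lemma probe_orthant r i k : 0 <= r -> (i < k)%N -> orthant R k (probe r i).
Proof.
move=> r0 ik; split=> [[|j] //=|[|j] //= kj]; rewrite ?ler0n //.
by case: eqP kj => // ->; rewrite ltnS leqNgt ik.
Qed.

Lemma Delta_probe c G (fs : seq (signal R G)) r i (u v : G) :
  (i < size fs)%N ->
  Delta c fs (probe r i) u v =
    Num.sqrt ((fs`_i u - fs`_i v) ^+ 2 + dist c u v ^+ 2).
Proof.
move=> ifs; rewrite /Delta (bigD1 (Ordinal ifs)) //= eqxx mul1r big1 ?addr0 //.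
by move=> j; rewrite -val_eqE /= => /negbTE ->; rewrite mul0r.
Qed.

Lemma threshold_graph_recover c G (fs gs : seq (signal R G)) :
  size fs = size gs ->
  (forall x, orthant R (size fs) x ->
    threshold_graph c fs x = threshold_graph c gs x) ->
  forall i u v, (i < size fs)%N ->
    (fs`_i u - fs`_i v) ^+ 2 = (gs`_i u - gs`_i v) ^+ 2.
Proof.
move=> sz E i u v ifs; have igs : (i < size gs)%N by rewrite -sz.
have [->|uv] := eqVneq u v; first by rewrite !subrr.
have DE r : 0 <= r -> (Delta c fs (probe r i) u v <= r) =
    (Delta c gs (probe r i) u v <= r).
  move=> r0; have /graph_eq_adj := E _ (probe_orthant r0 ifs).
  by move=> /(congr1 (fun e => e u v)); rewrite /threshold_rel /= uv.
have sum_ge0 (a b : R) : 0 <= a ^+ 2 + b ^+ 2 by rewrite addr_ge0 ?sqr_ge0.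
apply: (addIr (dist c u v ^+ 2)).
apply/eqP; rewrite -eqr_sqrt // eq_le.
(* With the value of [Delta] for [gs] as radius, [u] and [v] are joined for [gs], hence for [fs],
   which gives one inequality; swapping the roles gives the other. *)
rewrite -{1}(Delta_probe _ (Num.sqrt ((gs`_i u - gs`_i v) ^+ 2 + dist c u v ^+ 2)) _ _ ifs).
rewrite DE ?sqrtr_ge0 // Delta_probe // lexx /=.
rewrite -{1}(Delta_probe _ (Num.sqrt ((fs`_i u - fs`_i v) ^+ 2 + dist c u v ^+ 2)) _ _ igs).
by rewrite -DE ?sqrtr_ge0 // Delta_probe.
Qed.

Lemma signal_family_scaled c G (fs gs : seq (signal R G)) :
  signal_family c fs = signal_family c gs ->
  forall f, f \in fs -> exists2 g, g \in gs & scaled f g.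
Proof.
move=> /signal_family_inj[sz E] f ffs.
have ifs : (index f fs < size fs)%N by rewrite index_mem.
exists gs`_(index f fs); first by rewrite mem_nth -?sz.
exists 1 => // u v; rewrite mul1r -(threshold_graph_recover sz E) //.
by rewrite nth_index.
Qed.

End SignalFamily.

(* enum lists the signals of a finite set F as f_1, ..., f_k in any order;
   far G is the value of d_G on pairs of vertices in different components. *)
Theorem theorem1 (R : realType)
  (enum : forall G : graph, {fset signal R G} -> seq (signal R G))
  (far : graph -> R)
  (henum : forall (G : graph) (F : {fset signal R G}),
    perm_eq (enum G F) (enum_fset F))
  (hfar : forall G : graph, 1 < far G) :
  is_coupling family_equiv
    (fun (G : graph) (F : {fset signal R G}) =>
       signal_family (far G) (enum G F)).
Proof.
have mem_enum G (F : {fset signal R G}) : enum G F =i F.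
  exact: perm_mem (henum G F).
have enum1 G (f : signal R G) : enum G [fset f] = [:: f].
  apply: perm_small_eq => //; apply: uniq_perm => //.
    by rewrite (perm_uniq (henum _ _)) fset_uniq.
  by move=> g; rewrite mem_enum !inE.
pose obj G F := signal_family (far G) (enum G F).
split.
- exact: family_equiv_equivalence.
(* The representative is picked by choice; [s] itself is the default when [s] is no family of
   signals on [G]. *)
- pose comp s G (F' : {fset signal R G}) :=
    if pselect (exists F, obj G F = s) is left ex
    then obj G (projT1 (cid ex) `|` F') else s.
  exists comp => G F F'; rewrite /comp.
  case: pselect => [ex|nex]; last by case: nex; exists F.
  case: cid => /= F0 F0F.
  have union_scaled (A B : {fset signal R G}) : obj G A = obj G B ->
      forall f, f \in enum G (A `|` F') ->
      exists2 g, g \in enum G (B `|` F') & scaled f g.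
    move=> AB f; rewrite mem_enum in_fsetU => /orP[fA|fF'].
      have [|g gB fg] := signal_family_scaled AB (f := f).
        by rewrite mem_enum.
      by exists g => //; rewrite mem_enum in_fsetU -mem_enum gB.
    exists f; last exact: scaled_refl.
    by rewrite mem_enum in_fsetU fF' orbT.
  by apply: signal_family_equiv; exact: union_scaled.
- have obj_inj G G' F F' : obj G F = obj G' F' -> G = G'.
    move=> /signal_family_inj[_ /(_ _ (unit_scale_orthant _ _))].
    by rewrite !threshold_graph_unit.
  (* The chosen graph is the right one by [obj_inj]; families outside the image go to the empty
     graph. *)
  pose b s : graph :=
    if pselect (exists G F, obj G F = s) is left ex then projT1 (cid ex)
    else Graph (vertex := void) (adj := fun _ _ => false)
           (fun _ _ => erefl) (fun _ => erefl).
  exists b => G F; rewrite /b.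
  case: pselect => [ex|nex]; last by case: nex; exists G, F.
  by case: cid => /= G0 [F0 /obj_inj].
- move=> G f f' /signal_family_inj[sz E] u v; apply: eq_sqr_norm.
  have := threshold_graph_recover sz E (i := 0%N) u v.
  by rewrite !enum1; apply.
- move=> G f f' a c a0 fE.
  (* Since [a] is nonzero the affine relation inverts, which yields the morphism back. *)
  have fE' v : f' v = a^-1 * f v + - (a^-1 * c).
    by rewrite fE mulrDr addrK mulKf.
  apply: signal_family_equiv => g; rewrite enum1 inE => /eqP ->.
    by exists f'; [rewrite enum1 inE|exact: scaled_affine fE].
  by exists f; [rewrite enum1 inE|exact: scaled_affine fE'].
Qed.
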